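(* Let $C_1,C_2\subseteq\Gamma_2=\mathbb{Z}_3^2\times\mathbb{Z}_8\times\mathbb{Z}_4$ be the explicit sets given in the context. Then the pair $E_3=\{C_1,C_2\}$ is a $(144,12,2,-)$ covering extended building set on $\Gamma_2$. The character $\lambda(u,v,x,z)=\zeta_3^{v}\zeta_8^{x}(-1)^{z}$ of $\Gamma_2$ is Gauss-covered by $E_3$, with $$\lambda(C_1)=0,\qquad \lambda(C_2)=4(\zeta_3-\zeta_3^2)\,X\,\zeta_3^{2}.$$
   Context: Write $\zeta_m=e^{2\pi i/m}$ and $X=1+\zeta_8+\zeta_8^3$. For a positive integer $n$ divisible by $3$, a Gauss value of modulus $n$ is a complex number of the form $\frac n3(\zeta_3-\zeta_3^2)Y\zeta$ with $Y\in\{X,\overline X\}$ and $\zeta$ a root of unity. For a subset $B$ of a finite abelian group $K$ and a complex character $\chi$ of $K$, $\chi(B)=\sum_{g\in B}\chi(g)$. A building block in $K$ with modulus $m$ is a subset $B\subseteq K$ with $|\chi(B)|\in\{0,m\}$ for all nontrivial characters $\chi$ of $K$. An $(a,m,s,-)$ covering extended building set (covering EBS) on $K$ is a collection $\{B_1,\dots,B_s\}$ of building blocks in $K$ with modulus $m$, with $|B_1|=a-m$ and $|B_i|=a$ for $i\ge 2$, such that for every nontrivial character $\chi$ of $K$ one has $|\chi(B_i)|=m$ for exactly one $i$. A character $\chi$ is Gauss-covered by the covering EBS if, for the unique $i$ with $|\chi(B_i)|=m$, the number $\chi(B_i)$ is a Gauss value of modulus $m$. Let $W=\mathbb{Z}_3^2$.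 Elements of $\Gamma_2=W\times\mathbb{Z}_8\times\mathbb{Z}_4$ are written $(u,v,x,z)$ with $(u,v)\in W$, $x\in\mathbb{Z}_8$, $z\in\mathbb{Z}_4$. For $n=1,2$ set $C_n=\bigcup_{(u,v)\in W}\{(u,v)\}\times C^{(n)}_{(u,v)}$, where $C^{(n)}_{(u,v)}\subseteq\mathbb{Z}_8\times\mathbb{Z}_4$ is given by its $8\times 4$ indicator matrix, listed below as the rows $x=0,1,\dots,7$ in order; each row is a four-digit string whose digits are the entries for $z=0,1,2,3$ (so $(x,z)\in C^{(n)}_{(u,v)}$ iff the corresponding digit is $1$): $C^{(1)}_{(0,0)}$: 1011, 1011, 1011, 0100, 1011, 1011, 1011, 0100 $C^{(1)}_{(0,1)}$: 0000, 0000, 0000, 1111, 0000, 0000, 0000, 1111 $C^{(1)}_{(0,2)}$: 0000, 0000, 0000, 1111, 0000, 0000, 0000, 1111 $C^{(1)}_{(1,0)}$: 0101, 0101, 0101, 1010, 0101, 0101, 0101, 1010 $C^{(1)}_{(1,1)}$: 1100, 1100, 1100, 0011, 1100, 1100, 1100, 0011 $C^{(1)}_{(1,2)}$: 0110, 0110, 0110, 1001, 0110, 0110, 0110, 1001 $C^{(1)}_{(2,0)}$: 0101, 0101, 0101, 1010, 0101, 0101, 0101, 1010 $C^{(1)}_{(2,1)}$: 0110, 0110, 0110, 1001, 0110, 0110, 0110, 1001 $C^{(1)}_{(2,2)}$: 1100, 1100, 1100, 0011, 1100, 1100, 1100, 0011 $C^{(2)}_{(0,0)}$: 1100, 0110,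 1100, 1001, 0011, 1001, 0011, 0110 $C^{(2)}_{(0,1)}$: 0101, 0101, 1010, 0101, 1010, 1010, 0101, 1010 $C^{(2)}_{(0,2)}$: 0000, 1111, 0000, 0000, 1111, 0000, 1111, 1111 $C^{(2)}_{(1,0)}$: 1010, 1010, 1010, 1010, 0101, 0101, 0101, 0101 $C^{(2)}_{(1,1)}$: 1100, 0110, 1100, 1001, 0011, 1001, 0011, 0110 $C^{(2)}_{(1,2)}$: 0000, 0000, 1111, 1111, 1111, 1111, 0000, 0000 $C^{(2)}_{(2,0)}$: 0011, 0110, 0011, 1001, 1100, 1001, 1100, 0110 $C^{(2)}_{(2,1)}$: 0011, 0110, 0011, 1001, 1100, 1001, 1100, 0110 $C^{(2)}_{(2,2)}$: 0000, 1001, 1010, 0110, 1111, 0110, 0101, 1001 *)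

(* Defs.v *)
From Stdlib Require Import Ascii String.
From HB Require Import structures.
From mathcomp Require Import all_boot all_order all_algebra.
From mathcomp Require Import complex.
From mathcomp Require Import reals trigo.

Set Implicit Arguments.
Unset Strict Implicit.
Unset Printing Implicit Defensive.

Import Order.TTheory GRing.Theory Num.Theory.
Local Open Scope ring_scope.
Local Open Scope complex_scope.

(* e^(2 pi i / m) *)
Definition zeta {R : realType} (m : nat) : R[i] :=
  cos (2 * pi / m%:R) +i* sin (2 * pi / m%:R).

Definition gaussX {R : realType} : R[i] := 1 + zeta 8 + zeta 8 ^+ 3.

(* The condition 0 < k is needed: every z satisfies 0.-unity_root z. *)
Definition is_root_of_unity {R : realType} (z : R[i]) : Prop :=
  exists2 k : nat, (0 < k)%N & k.-unity_root z.

Definition gauss_value {R : realType} (n : nat) (w : R[i]) : Prop :=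
  [/\ (0 < n)%N, (3 %| n)%N &
      exists Y z : R[i],
        [/\ Y = gaussX \/ Y = Num.conj gaussX, is_root_of_unity z &
            w = n%:R / 3 * (zeta 3 - zeta 3 ^+ 2) * Y * z]].

Definition is_character {R : realType} {K : finZmodType} (chi : K -> R[i]) : Prop :=
  chi 0 = 1 /\ (forall g h, chi (g + h) = chi g * chi h).

Definition nontrivial {R : realType} {K : finZmodType} (chi : K -> R[i]) : Prop :=
  exists g, chi g != 1.

Definition char_sum {R : realType} {K : finZmodType} (chi : K -> R[i])
    (B : {set K}) : R[i] :=
  \sum_(g in B) chi g.

Definition building_block (R : realType) {K : finZmodType} (m : nat)
    (B : {set K}) : Prop :=
  forall chi : K -> R[i], is_character chi -> nontrivial chi ->
    `|char_sum chi B| = 0 \/ `|char_sum chi B| = m%:R.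

(* An (a, m, s, -) covering EBS; B_1, the block of size a - m, is the entry of
   index 0.  The size condition is written #|B_1| + m = a because subtraction
   on nat is truncated. *)
Definition covering_EBS (R : realType) {K : finZmodType} (a m s : nat)
    (B : s.-tuple {set K}) : Prop :=
  [/\ (0 < s)%N,
      forall i : 'I_s, building_block R m (tnth B i),
      forall i : 'I_s, if i == 0%N :> nat then (#|tnth B i| + m)%N = a
                       else #|tnth B i| = a &
      forall chi : K -> R[i], is_character chi -> nontrivial chi ->
        exists! i : 'I_s, `|char_sum chi (tnth B i)| = m%:R].

Definition gauss_covered {R : realType} {K : finZmodType} (m s : nat)
    (B : s.-tuple {set K}) (chi : K -> R[i]) : Prop :=
  exists i : 'I_s,
    unique (fun j : 'I_s => `|char_sum chi (tnth B j)| = m%:R) i /\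
    gauss_value m (char_sum chi (tnth B i)).

(* An element ((u, v), x, z) of W * Z_8 * Z_4, where W = Z_3^2.  The
   instances are declared explicitly because the library has no finZmodType
   instance for product types. *)
Definition Gamma2 : Type := ('Z_3 * 'Z_3 * 'Z_8 * 'Z_4)%type.
HB.instance Definition _ := Finite.on Gamma2.
HB.instance Definition _ := GRing.Zmodule.on Gamma2.

(* rowsN u v is the 8 x 4 indicator matrix of C^(N)_(u,v): the digit of index z
   in the string of index x is 1 if and only if (x, z) is in C^(N)_(u,v). *)
Definition rows1 (u v : nat) : seq string :=
  match u, v with
  | 0, 0 => [:: "1011"; "1011"; "1011"; "0100"; "1011"; "1011"; "1011"; "0100"]
  | 0, 1 => [:: "0000"; "0000"; "0000"; "1111"; "0000"; "0000"; "0000"; "1111"]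
  | 0, 2 => [:: "0000"; "0000"; "0000"; "1111"; "0000"; "0000"; "0000"; "1111"]
  | 1, 0 => [:: "0101"; "0101"; "0101"; "1010"; "0101"; "0101"; "0101"; "1010"]
  | 1, 1 => [:: "1100"; "1100"; "1100"; "0011"; "1100"; "1100"; "1100"; "0011"]
  | 1, 2 => [:: "0110"; "0110"; "0110"; "1001"; "0110"; "0110"; "0110"; "1001"]
  | 2, 0 => [:: "0101"; "0101"; "0101"; "1010"; "0101"; "0101"; "0101"; "1010"]
  | 2, 1 => [:: "0110"; "0110"; "0110"; "1001"; "0110"; "0110"; "0110"; "1001"]
  | 2, 2 => [:: "1100"; "1100"; "1100"; "0011"; "1100"; "1100"; "1100"; "0011"]
  | _, _ => [::]
  end%string.

Definition rows2 (u v : nat) : seq string :=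
  match u, v with
  | 0, 0 => [:: "1100"; "0110"; "1100"; "1001"; "0011"; "1001"; "0011"; "0110"]
  | 0, 1 => [:: "0101"; "0101"; "1010"; "0101"; "1010"; "1010"; "0101"; "1010"]
  | 0, 2 => [:: "0000"; "1111"; "0000"; "0000"; "1111"; "0000"; "1111"; "1111"]
  | 1, 0 => [:: "1010"; "1010"; "1010"; "1010"; "0101"; "0101"; "0101"; "0101"]
  | 1, 1 => [:: "1100"; "0110"; "1100"; "1001"; "0011"; "1001"; "0011"; "0110"]
  | 1, 2 => [:: "0000"; "0000"; "1111"; "1111"; "1111"; "1111"; "0000"; "0000"]
  | 2, 0 => [:: "0011"; "0110"; "0011"; "1001"; "1100"; "1001"; "1100"; "0110"]
  | 2, 1 => [:: "0011"; "0110"; "0011"; "1001"; "1100"; "1001"; "1100"; "0110"]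
  | 2, 2 => [:: "0000"; "1001"; "1010"; "0110"; "1111"; "0110"; "0101"; "1001"]
  | _, _ => [::]
  end%string.

Definition entry (rows : seq string) (x z : nat) : bool :=
  if String.get z (nth EmptyString rows x) is Some "1"%char then true else false.

Definition C1 : {set Gamma2} :=
  [set g : Gamma2 | let: (u, v, x, z) := g in entry (rows1 u v) x z].

Definition C2 : {set Gamma2} :=
  [set g : Gamma2 | let: (u, v, x, z) := g in entry (rows2 u v) x z].

Definition E3 : 2.-tuple {set Gamma2} := [tuple C1; C2].

Definition lambda {R : realType} (g : Gamma2) : R[i] :=
  let: (u, v, x, z) := g in zeta 3 ^+ v * zeta 8 ^+ x * (-1) ^+ z.

(* Main.v *)
(** Every character of [Gamma2] sends [(u, v, x, z)] to [t ^ (8iu + 8jv + 3kx + 6lz)]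
    for [t = zeta 24], so a character sum over a block is determined by the
    numbers of its exponents in each class mod 24, and its squared modulus by
    the cyclic autocorrelation of these numbers, because conj [t] is [t^-1].
    Since [t^8 = t^4 - 1], eight integer coordinates suffice to recognise the
    values 0 and 144, which is checked for each of the 287 nontrivial
    characters. *)
Require Import Defs.
From HB Require Import structures.
From mathcomp Require Import all_boot all_order all_algebra.
From mathcomp Require Import complex.
From mathcomp Require Import reals trigo.
From mathcomp Require Import ring lra.

Set Implicit Arguments.
Unset Strict Implicit.
Unset Printing Implicit Defensive.

Import Order.TTheory GRing.Theory Num.Theory.
Local Open Scope ring_scope.
Local Open Scope complex_scope.

(** * Roots of unity and [zeta 24] *)

Lemma zetaX (R : realType) (m k : nat) :
  zeta m ^+ k
  = cos (2 * pi / m%:R *+ k) +i* sin (2 * pi / m%:R *+ k) :> R[i].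
Proof.
elim: k => [|k IHk]; first by rewrite expr0 mulr0n cos0 sin0.
rewrite exprS IHk /zeta (mulrS _ k) cosD sinD.
by apply/eqP; rewrite eq_complex /= !eqxx /= addrC.
Qed.

Lemma zeta_root (R : realType) (m d : nat) :
  (0 < d)%N -> zeta (m * d) ^+ d = zeta m :> R[i].
Proof.
move=> d_gt0; rewrite zetaX /zeta natrM -mulr_natr invfM mulrA.
by rewrite mulfVK // pnatr_eq0 -lt0n.
Qed.

Lemma zeta_half (R : realType) (m : nat) :
  (0 < m)%N -> zeta (m * 2) ^+ m = -1 :> R[i].
Proof.
move=> m_gt0; rewrite zetaX natrM -mulr_natr.
have -> : 2 * pi / (m%:R * 2) * m%:R = pi :> R.
  by field; rewrite pnatr_eq0 -lt0n.
by rewrite cospi sinpi; apply/eqP; rewrite eq_complex /= oppr0 !eqxx.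
Qed.

(** With [w = zeta 24 ^+ 4], the factor [w + 1] cancels from [w^3 + 1 = (w + 1)(w^2 - w + 1) = 0];
    it is nonzero because [w = zeta 6] has imaginary part [sin (pi / 3) > 0]. *)
Lemma zeta24_minpoly (R : realType) : zeta 24 ^+ 8 = zeta 24 ^+ 4 - 1 :> R[i].
Proof.
have w3 : (zeta 24 ^+ 4) ^+ 3 = -1 :> R[i].
  by rewrite -exprM (@zeta_half R 12).
have wN1 : (zeta 24 ^+ 4 : R[i]) + 1 != 0.
  rewrite (@zeta_root R 6 4) // /zeta eq_complex /= addr0 negb_and orbC.
  rewrite gt_eqF // sin_gt0_pi //.
  by have pi0 := pi_gt0 R; apply/andP; split; lra.
apply: (mulfI wN1).
rewrite -[8%N]/(4 * 2)%N exprM.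
move: (zeta 24 ^+ 4) w3 => w w3.
have -> : (w + 1) * w ^+ 2 = w ^+ 3 + w ^+ 2 by ring.
by rewrite w3; ring.
Qed.

(** The order divides 24, and every divisor of 24 other than 24 itself divides 12 or 8; both are
    excluded. *)
Lemma zeta24_prim (R : realType) : 24.-primitive_root (zeta 24 : R[i]).
Proof.
have t12 : zeta 24 ^+ 12 = -1 :> R[i] by rewrite (@zeta_half R 12).
have N11 : (-1 : R[i]) != 1 by rewrite eqNr oner_eq0.
have [|d d_prim dv] := @prim_order_exists _ 24 (zeta 24 : R[i]) isT.
  by rewrite -[24%N]/(12 * 2)%N exprM t12 sqrrN expr1n.
have d12 : ~~ (d %| 12)%N by rewrite (prim_order_dvd d_prim) t12.
have d8 : ~~ (d %| 8)%N.
  (* If [t^8 = 1], then [t^4 = 2], so [t^12 = 2], against [t^12 = -1]. *)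
  rewrite (prim_order_dvd d_prim) zeta24_minpoly; apply/eqP => t4.
  have : (zeta 24 : R[i]) ^+ 12 = 2.
    have -> : 12%N = (4 + 8)%N by [].
    by rewrite exprD zeta24_minpoly t4 mulr1 -[LHS](subrK 1) t4.
  by rewrite t12 => /eqP; rewrite lt_eqF // (lt_trans (ltrN10 _)) ?ltr0n.
have := dv; rewrite dvdn_divisors // => d_div.
suff : d == 24%N by move/eqP => d24; rewrite d24 in d_prim.
have /allP/(_ d d_div) : all (fun d => [|| d %| 12, d %| 8 | d == 24])%N (divisors 24).
  by vm_compute.
by rewrite (negPf d12) (negPf d8).
Qed.

(** * Sums of powers of a root of unity, through exponent counts *)

Definition tally (s : seq nat) : seq nat :=
  let s' := [seq (e %% 24)%N | e <- s] in [seq count_mem r s' | r <- iota 0 24].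

Definition autocorr (n : seq nat) : seq nat :=
  [seq sumn [seq (nth 0 n ((s + d) %% 24) * nth 0 n s)%N | s <- iota 0 24]
  | d <- iota 0 24].

(* Coordinates of [\sum_r n_r t^r] on [1, t, ..., t^7] when [t^8 = t^4 - 1],
   from [t^(12 + r) = - t^r] and [t^(8 + r) = t^(4 + r) - t^r]. *)
Definition coords (n : seq nat) : seq int :=
  [seq (nth 0 n r)%:Z - (nth 0 n (12 + r))%:Z - (nth 0 n (8 + r))%:Z
        + (nth 0 n (20 + r))%:Z | r <- iota 0 4]
  ++ [seq (nth 0 n (4 + r))%:Z - (nth 0 n (16 + r))%:Z + (nth 0 n (8 + r))%:Z
        - (nth 0 n (20 + r))%:Z | r <- iota 0 4].

Definition weval (A : pzRingType) (t : A) (n : seq nat) : A :=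
  \sum_(r < 24) (nth 0 n r)%:R * t ^+ r.

Lemma weval_coords (A : comNzRingType) (t : A) (n : seq nat) :
  t ^+ 8 = t ^+ 4 - 1 ->
  weval t n = \sum_(j < 8) (nth 0 (coords n) j)%:~R * t ^+ j.
Proof.
move=> t8; rewrite /weval.
have e8 r : t ^+ (r + 8) = t ^+ (r + 4) - t ^+ r by rewrite !exprD t8; ring.
have e12 r : t ^+ (r + 12) = - t ^+ r.
  by rewrite -[12%N]/(4 + 8)%N addnA e8 -addnA e8; ring.
rewrite !big_ord_recr !big_ord0 /= !(rmorphB, rmorphD) /= -!pmulrn.
(* Exponents 12 to 23 first drop below 12, which leaves only 8 to 11 for [e8]. *)
rewrite [t ^+ 23](e12 11%N) [t ^+ 22](e12 10%N) [t ^+ 21](e12 9%N).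
rewrite [t ^+ 20](e12 8%N) [t ^+ 19](e12 7%N) [t ^+ 18](e12 6%N).
rewrite [t ^+ 17](e12 5%N) [t ^+ 16](e12 4%N) [t ^+ 15](e12 3%N).
rewrite [t ^+ 14](e12 2%N) [t ^+ 13](e12 1%N) [t ^+ 12](e12 0%N).
rewrite [t ^+ 11](e8 3%N) [t ^+ 10](e8 2%N) [t ^+ 9](e8 1%N).
rewrite [t ^+ 8](e8 0%N).
rewrite !addSn !add0n; ring.
Qed.

Lemma weval_tally (A : pzRingType) (t : A) (s : seq nat) :
  t ^+ 24 = 1 -> \sum_(e <- s) t ^+ e = weval t (tally s).
Proof.
move=> t24; rewrite /weval /tally.
under [RHS]eq_bigr => r _ do
  rewrite (nth_map 0%N) ?size_iota // nth_iota // add0n count_map -sum1_count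
          natr_sum mulr_suml.
under [RHS]eq_bigr => r _ do rewrite big_mkcond.
(* With the sums exchanged, each exponent [e] contributes only at [r = e %% 24]. *)
rewrite exchange_big /=; apply: eq_bigr => e _.
rewrite -big_mkcond /= (bigD1 (Ordinal (ltn_pmod e (isT : 0 < 24)%N))) //=.
rewrite mul1r (expr_mod _ t24) big1 ?addr0 // => i /andP[/eqP ei /negP[]].
by apply/eqP/val_inj.
Qed.

Lemma weval_autocorr (C : numClosedFieldType) (t : C) (n : seq nat) :
  t ^+ 24 = 1 -> `|weval t n| ^+ 2 = weval t (autocorr n).
Proof.
move=> t24.
have t_neq0 : t != 0.
  by apply: contraTneq (oner_neq0 C) => t0; rewrite -t24 t0 expr0n eqxx.
have tJ : Num.conj t = t^-1.
  rewrite invC_norm.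
  have /eqP : `|t| ^+ 24 = 1 by rewrite -normrX t24 normr1.
  by rewrite pexprn_eq1 // => /eqP->; rewrite expr1n invr1 mul1r.
rewrite normCK /weval rmorph_sum big_distrlr exchange_big /=.
under [RHS]eq_bigr => d _.
  rewrite (nth_map 0%N) ?size_iota // nth_iota // add0n sumnE big_map.
  rewrite -[iota 0 24]/(index_iota 0 24) big_mkord natr_sum mulr_suml.
  over.
rewrite [RHS]exchange_big /=; apply: eq_bigr => s _.
(* The first index becomes [s + d] in the cyclic group of order 24, so that [d] is the lag of the
   autocorrelation. *)
rewrite (reindex_inj (@addrI 'Z_24 s)) /=; apply: eq_bigr => d _.
rewrite rmorphM rmorph_nat rmorphXn /= tJ (expr_mod _ t24) natrM exprD exprVn.
by rewrite /Zp_trunc /=; field; rewrite expf_neq0.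
Qed.

(** * Blocks as lists, and the characters of [Gamma2] *)

Definition support (rows : nat -> nat -> seq String.string) :
    seq (nat * nat * nat * nat) :=
  [seq p <- [seq (q, z) | q <- [seq (q, x) | q <-
              [seq (u, v) | u <- iota 0 3, v <- iota 0 3], x <- iota 0 8],
              z <- iota 0 4]
  | let: (u, v, x, z) := p in entry (rows u v) x z].

Definition reps (g : Gamma2) : nat * nat * nat * nat :=
  let: (u, v, x, z) := g in (nat_of_ord u, nat_of_ord v, nat_of_ord x, nat_of_ord z).

Lemma big_pair (T : Type) (idx : T) (op : Monoid.com_law idx) (I J : finType)
    (F : I * J -> T) :
  \big[op/idx]_p F p = \big[op/idx]_i \big[op/idx]_j F (i, j).
Proof. by rewrite pair_bigA; apply: eq_bigr => -[]. Qed.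

(** Passes from a block to a list on which computation can run. The operation is arbitrary because
    both character sums and cardinalities use this. *)
Lemma big_support (T : Type) (idx : T) (op : Monoid.com_law idx)
    (rows : nat -> nat -> seq String.string) (F : nat * nat * nat * nat -> T) :
  \big[op/idx]_(g in [set g : Gamma2 | let: (u, v, x, z) := g in
                                       entry (rows u v) x z]) F (reps g)
  = \big[op/idx]_(p <- support rows) F p.
Proof.
rewrite big_mkcond /support big_filter [RHS]big_mkcond !big_allpairs.
have big_iota m (G : nat -> T) :
    \big[op/idx]_(i <- iota 0 m) G i = \big[op/idx]_(i < m) G i.
  by rewrite -[m in iota 0 m]subn0 -/(index_iota 0 m) big_mkord.
rewrite big_iota; apply: etrans (big_pair _ _) _; rewrite !big_pair.
apply: eq_bigr => u _; rewrite big_iota; apply: eq_bigr => v _.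
rewrite big_iota; apply: eq_bigr => x _; rewrite big_iota; apply: eq_bigr => z _.
by rewrite inE.
Qed.

(** The weights 8, 3 and 6 are 24/3, 24/8 and 24/4, so the matching powers of [zeta 24] have orders
    3, 8 and 4. *)
Definition expo (i j k l : nat) (p : nat * nat * nat * nat) : nat :=
  let: (u, v, x, z) := p in
  (8 * i * u + 8 * j * v + 3 * k * x + 6 * l * z)%N.

Definition char_tally (i j k l : nat) (s : seq (nat * nat * nat * nat)) : seq nat :=
  tally (map (expo i j k l) s).

(** The element 1 generates ['Z_m], and [f 1] is an [m]-th root of unity, hence a power of [w]. *)
Lemma character_Zp (F : fieldType) (m : nat) (w : F) (f : 'Z_m -> F) :
  (1 < m)%N -> m.-primitive_root w ->
  f 0 = 1 -> {morph f : x y / x + y >-> x * y} ->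
  exists2 i, (i < m)%N & forall x, f x = w ^+ (i * x).
Proof.
move=> m_gt1 w_prim f0 fD.
have fX n : f (n%:R) = f 1 ^+ n.
  by elim: n => [|n IHn]; rewrite ?f0 // mulrS fD IHn exprS.
have [|i fi] := prim_rootP w_prim (x := f 1).
  by rewrite -fX pchar_Zp.
by exists i => // x; rewrite -[in LHS](natr_Zp x) fX fi exprM.
Qed.

Lemma Gamma2_character (R : realType) (chi : Gamma2 -> R[i]) :
  is_character chi ->
  exists i j k l, [/\ (i < 3)%N, (j < 3)%N, (k < 8)%N, (l < 4)%N &
    forall g, chi g = zeta 24 ^+ expo i j k l (reps g)].
Proof.
move=> [chi0 chiD]; have t_prim := zeta24_prim R.
have [||||i i3 chi_u] := @character_Zp _ 3 (zeta 24 ^+ 8 : R[i])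
  (fun u => chi (u, 0, 0, 0)) => //.
- exact: (dvdn_prim_root t_prim).
- by move=> u u'; rewrite -chiD; congr (chi (_, _, _, _)); rewrite addr0.
have [||||j j3 chi_v] := @character_Zp _ 3 (zeta 24 ^+ 8 : R[i])
  (fun v => chi (0, v, 0, 0)) => //.
- exact: (dvdn_prim_root t_prim).
- by move=> u u'; rewrite -chiD; congr (chi (_, _, _, _)); rewrite addr0.
have [||||k k8 chi_x] := @character_Zp _ 8 (zeta 24 ^+ 3 : R[i])
  (fun x => chi (0, 0, x, 0)) => //.
- exact: (dvdn_prim_root t_prim).
- by move=> u u'; rewrite -chiD; congr (chi (_, _, _, _)); rewrite addr0.
have [||||l l4 chi_z] := @character_Zp _ 4 (zeta 24 ^+ 6 : R[i])
  (fun z => chi (0, 0, 0, z)) => //.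
- exact: (dvdn_prim_root t_prim).
- by move=> u u'; rewrite -chiD; congr (chi (_, _, _, _)); rewrite addr0.
exists i, j, k, l; split=> // -[[[u v] x] z] /=.
(* The restrictions of [chi] to the four cyclic factors determine it. *)
have -> : (u, v, x, z) = (u, 0, 0, 0) + (0, v, 0, 0) + (0, 0, x, 0) + (0, 0, 0, z)
    :> Gamma2.
  rewrite -[RHS]/((u + 0 + 0 + 0, 0 + v + 0 + 0, 0 + 0 + x + 0, 0 + 0 + 0 + z)
                  : Gamma2).
  by rewrite !addr0 !add0r.
by rewrite !chiD chi_u chi_v chi_x chi_z -!exprM !mulnA -!exprD.
Qed.

(** * The finite check over all characters *)

Definition const_coords (n : nat) : seq int := n%:Z :: nseq 7 0.

Lemma weval_const (A : comNzRingType) (t : A) (n : seq nat) (c : nat) :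
  t ^+ 8 = t ^+ 4 - 1 -> coords n = const_coords c -> weval t n = c%:R.
Proof.
move=> t8 nc; rewrite weval_coords // nc big_ord_recl expr0 mulr1 big1 ?addr0 //.
by move=> i _; rewrite -[nth _ _ _]/(nth 0 (nseq 7 (0 : int)) i) nth_nseq if_same mul0r.
Qed.

Definition vanishes_at (i j k l : nat) (s : seq (nat * nat * nat * nat)) : bool :=
  coords (char_tally i j k l s) == const_coords 0.

(** The test bears on the squared modulus, and 144 is the square of 12. *)
Definition modulus12_at (i j k l : nat) (s : seq (nat * nat * nat * nat)) : bool :=
  coords (autocorr (char_tally i j k l s)) == const_coords 144.

(** A closed boolean over all 288 exponent quadruples; the first alternative sets the trivial
    character aside. *)
Lemma support_characters :
  all (fun i => all (fun j => all (fun k => all (fun l =>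
    [|| [&& i == 0, j == 0, k == 0 & l == 0],
        vanishes_at i j k l (support rows1) && modulus12_at i j k l (support rows2) |
        modulus12_at i j k l (support rows1) && vanishes_at i j k l (support rows2)])
  (iota 0 4)) (iota 0 8)) (iota 0 3)) (iota 0 3).
Proof. by vm_compute. Qed.

Lemma char_sumE (R : realType) (i j k l : nat) (chi : Gamma2 -> R[i])
    (rows : nat -> nat -> seq String.string) :
  (forall g, chi g = zeta 24 ^+ expo i j k l (reps g)) ->
  char_sum chi [set g : Gamma2 | let: (u, v, x, z) := g in entry (rows u v) x z]
  = weval (zeta 24) (char_tally i j k l (support rows)).
Proof.
move=> chiE; rewrite /char_sum; under eq_bigr do rewrite chiE.
rewrite (big_support _ _ (fun p => zeta 24 ^+ expo i j k l p)).
by rewrite -weval_tally ?big_map // prim_expr_order // zeta24_prim.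
Qed.

Lemma char_sums (R : realType) (chi : Gamma2 -> R[i]) :
  is_character chi -> nontrivial chi ->
  (char_sum chi C1 = 0 /\ `|char_sum chi C2| = 12) \/
  (`|char_sum chi C1| = 12 /\ char_sum chi C2 = 0).
Proof.
move=> chi_char [g chi_g].
have [i [j [k [l [i3 j3 k8 l4 chiE]]]]] := Gamma2_character chi_char.
have t8 := zeta24_minpoly R.
have t24 : zeta 24 ^+ 24 = 1 :> R[i] by rewrite prim_expr_order // zeta24_prim.
have zeroP s : vanishes_at i j k l s ->
    weval (zeta 24) (char_tally i j k l s) = 0 :> R[i].
  by move=> /eqP; apply: weval_const.
have modP s : modulus12_at i j k l s ->
    `|weval (zeta 24) (char_tally i j k l s) : R[i]| = 12.
  move=> /eqP /(weval_const t8) norm2; apply/eqP.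
  by rewrite -(eqrXn2 (n := 2)) // weval_autocorr // norm2 -natrX.
have := support_characters.
move=> /allP/(_ i); rewrite mem_iota => /(_ i3).
move=> /allP/(_ j); rewrite mem_iota => /(_ j3).
move=> /allP/(_ k); rewrite mem_iota => /(_ k8).
move=> /allP/(_ l); rewrite mem_iota => /(_ l4).
rewrite /C1 /C2 !(char_sumE _ chiE).
move: (support rows1) (support rows2) => s1 s2.
case/or3P => [/and4P[/eqP i0 /eqP j0 /eqP k0 /eqP l0] | /andP[/zeroP-> /modP->] |].
(* Zero exponents make [chi] identically 1, against nontriviality. *)
- case/eqP: chi_g; rewrite chiE i0 j0 k0 l0.
  by case: g => [[[u v] x] z].
- by left.
- by case/andP=> /modP-> /zeroP->; right.
Qed.

(** * Block sizes and the covering property *)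

Lemma card_C1 : #|C1| = 132%N.
Proof.
by rewrite -sum1_card (big_support _ _ (fun=> 1%N)) sum1_size; vm_compute.
Qed.

Lemma card_C2 : #|C2| = 144%N.
Proof.
by rewrite -sum1_card (big_support _ _ (fun=> 1%N)) sum1_size; vm_compute.
Qed.

Lemma E3_covering (R : realType) : covering_EBS R 144 12 E3.
Proof.
(* Gives uniqueness of the index: a block with sum 0 does not have modulus 12. *)
have twelve0 : (0 : R[i]) <> 12 by move/esym/eqP; rewrite pnatr_eq0.
split=> //.
- move=> i chi chi_char chi_nt.
  have [[s1 s2]|[s1 s2]] := char_sums chi_char chi_nt;
    by case: i => -[|[|//]] i_lt; rewrite (tnth_nth set0) /= ?s1 ?s2 ?normr0; auto.
- case=> -[|[|//]] i_lt /=; rewrite (tnth_nth set0) /=; first by rewrite card_C1.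
  exact: card_C2.
move=> chi chi_char chi_nt.
have [[s1 s2]|[s1 s2]] := char_sums chi_char chi_nt.
- exists ord_max; split=> [|i]; rewrite (tnth_nth set0) //=.
  by case: i => -[|[|//]] i_lt /=; rewrite ?s1 ?normr0 // => _; apply: val_inj.
- exists ord0; split=> [|i]; rewrite (tnth_nth set0) //=.
  by case: i => -[|[|//]] i_lt /=; rewrite ?s2 ?normr0 // => _; apply: val_inj.
Qed.

(** * The character [lambda] and its Gauss value *)

Lemma lambda_char (R : realType) : is_character (@lambda R).
Proof.
have prim m : (m %| 24)%N -> (zeta m : R[i]) ^+ m = 1.
  move=> m24; have m_gt0 : (0 < m)%N by case: m m24.
  rewrite -{1}(@zeta_root R m (24 %/ m)); last by rewrite divn_gt0 // dvdn_leq.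
  by rewrite mulnC divnK // -exprM divnK // prim_expr_order // zeta24_prim.
split; first by rewrite /lambda /= !expr0 !mulr1.
move=> [[[u v] x] z] [[[u' v'] x'] z'].
(* Addition in each coordinate reduces modulo 3, 8 or 4, which the powers of the matching base do
   not see. *)
rewrite /lambda /= (expr_mod (v + v') (prim 3 isT)).
rewrite (expr_mod (x + x') (prim 8 isT)).
rewrite (@expr_mod R[i] 4 (-1) (z + z')); last first.
  by rewrite -[4%N]/(2 * 2)%N exprM sqrrN !expr1n.
by rewrite !exprD; ring.
Qed.

(** The last index is 2 because [-1 = zeta 24 ^+ 12] and [12 = 6 * 2]. *)
Lemma lambdaE (R : realType) (g : Gamma2) :
  lambda g = zeta 24 ^+ expo 0 1 1 2 (reps g) :> R[i].
Proof.
case: g => [[[u v] x] z] /=.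
rewrite -(@zeta_root R 3 8) // -(@zeta_root R 8 3) // -(@zeta_half R 12) //.
by rewrite -!exprM -!exprD !mul0n.
Qed.

Lemma lambda_C1 (R : realType) : char_sum (@lambda R) C1 = 0.
Proof.
rewrite /C1 (char_sumE _ (@lambdaE R)); apply: (@weval_const _ _ _ 0).
  exact: zeta24_minpoly.
by vm_compute.
Qed.

Lemma lambda_C2 (R : realType) :
  char_sum (@lambda R) C2 = 4 * (zeta 3 - zeta 3 ^+ 2) * gaussX * zeta 3 ^+ 2.
Proof.
have t24 : zeta 24 ^+ 24 = 1 :> R[i] by rewrite prim_expr_order // zeta24_prim.
have t8 := zeta24_minpoly R.
have tN r : zeta 24 ^+ (r + 12) = - zeta 24 ^+ r :> R[i].
  by rewrite exprD (@zeta_half R 12) // mulrN1.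
rewrite /C2 (char_sumE _ (@lambdaE R)).
(* With [t = zeta 24], the product without its factor 4 is [(t^24 - t^32)(1 + t^3 + t^9)]. Its
   negative terms become [t^44], [t^47], [t^53] by [t^12 = -1]; exponents stay unreduced modulo 24
   so that [ring] can conclude. *)
transitivity (\sum_(e <- flatten (nseq 4 [:: 24; 27; 33; 44; 47; 53])) zeta 24 ^+ e : R[i]).
  by rewrite (weval_tally _ t24) !weval_coords.
rewrite /gaussX -(@zeta_root R 3 8) // -(@zeta_root R 8 3) //.
rewrite !big_cons big_nil (tN 32%N) (tN 35%N) (tN 41%N).
by rewrite -!exprM; ring.
Qed.

Theorem theorem4p4 (R : realType) :
  covering_EBS R 144 12 E3 /\
  is_character (@lambda R) /\
  gauss_covered 12 E3 (@lambda R) /\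
  char_sum (@lambda R) C1 = 0 /\
  char_sum (@lambda R) C2 = 4 * (zeta 3 - zeta 3 ^+ 2) * gaussX * zeta 3 ^+ 2.
Proof.
have covering := E3_covering R; have lambdaP := lambda_char R.
have l1 := lambda_C1 R; have l2 := lambda_C2 R.
do !split=> //.
have nt : nontrivial (@lambda R).
  (* Here [lambda] takes the value -1. *)
  exists (0, 0, 0, 1); rewrite /lambda /= !expr0 !mul1r expr1.
  by rewrite eqNr oner_eq0.
have [_ _ _ /(_ _ lambdaP nt) [i [i12 i_uniq]]] := covering.
exists i; split=> //.
(* Index 0 is impossible since the sum over [C1] is 0, so the covering index is that of [C2]. *)
case: i i12 {i_uniq} => -[|[|//]] i_lt; rewrite (tnth_nth set0) /=.
  by rewrite l1 normr0 => /esym/eqP; rewrite pnatr_eq0.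
move=> _; split=> //; exists gaussX, (zeta 3 ^+ 2); split; [by left | | ].
  exists 3%N => //; rewrite unity_rootE -(@zeta_root R 3 8) // -!exprM.
  by rewrite -(prim_order_dvd (zeta24_prim R)).
rewrite l2; congr (_ * _ * _ * _).
by apply: (mulIf (x := 3)); rewrite ?pnatr_eq0 // divfK ?pnatr_eq0 // -natrM.
Qed.
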